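(* Let $G$ be a finite simple graph on the vertex set $[d]=\{1,\dots,d\}$ and let $r\ge2$ be an integer. Then $\omega(I_{\mathcal{S}_G})\le r$ if and only if for every $\mathbf{a}\in\mathbb{Z}_{\ge0}^d$, every $k$, and all $k$-vertex-colorings $f$ and $g$ of the vertex-replication graph $G_{\mathbf{a}}$, one has $f\sim_r g$.
   Context: A stable set of $G$ is a subset $S\subset[d]$ containing no two adjacent vertices (the empty set is stable). For $S\subset[d]$ put $\rho(S)=\sum_{j\in S}\mathbf{e}_j\in\mathbb{R}^d$. The stable set polytope is $\mathcal{S}_G=\mathrm{conv}\{\rho(S): S\text{ a stable set of }G\}$. Toric ideal: for a lattice polytope $\mathcal{P}\subset\mathbb{R}^d_{\ge0}$ with $\mathcal{P}\cap\mathbb{Z}^d=\{\mathbf{a}_1,\dots,\mathbf{a}_N\}$ and a field $\mathbb{K}$, $I_{\mathcal{P}}$ is the kernel of the $\mathbb{K}$-algebra map $\mathbb{K}[x_1,\dots,x_N]\to\mathbb{K}[t_1,\dots,t_d,s]$, $x_i\mapsto \mathbf{t}^{\mathbf{a}_i}s$, with $\deg x_i=1$. For a homogeneous ideal $I$, $\omega(I)$ is the maximal degree of minimal generators of $I$; by convention $\omega(\{0\})=2$ (so $\omega(I_{\mathcal P})\ge 2$ always). For $\mathbf{a}=(a_1,\dots,a_d)\in\mathbb{Z}_{\ge0}^d$, the vertex-replication graph $G_{\mathbf{a}}$ is obtained from $G$ by replacing each vertex $i$ with a complete graph $G^{(i)}$ on $a_i$ vertices (deleting $i$ if $a_i=0$)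 and joining every vertex of $G^{(i)}$ to every vertex of $G^{(j)}$ whenever $\{i,j\}$ is an edge of $G$. A $k$-vertex-coloring is an assignment of colors from $\{1,\dots,k\}$ to the vertices such that adjacent vertices get different colors (not all colors need be used). For a $k$-vertex-coloring $f$ and a color $j$, $M(f,j)$ is the set of vertices of color $j$. Two $k$-vertex-colorings $f,g$ differ by an $m$-colored subgraph if there is a set $S$ of $m$ colors with $M(f,j)\ne M(g,j)$ for $j\in S$ and $M(f,j)=M(g,j)$ for $j\notin S$. Write $f\sim_r g$ if there is a sequence $f=f_0,f_1,\dots,f_s=g$ of $k$-vertex-colorings of the graph such that $f_i$ differs from $f_{i-1}$ by a $k_i$-colored subgraph with $k_i\le r$ for each $i$. *)

(* Defs.v *)
From HB Require Import structures.
From mathcomp Require Import all_boot all_order all_algebra.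
From mathcomp Require Import boolp classical_sets reals.
From mathcomp Require Import mpoly.

Set Implicit Arguments.
Unset Strict Implicit.
Unset Printing Implicit Defensive.

Import Order.TTheory GRing.Theory Num.Theory.
Local Open Scope ring_scope.

(** A graph on [[d]] is an adjacency relation [e : rel 'I_d], assumed symmetric
    and irreflexive where it matters. *)

Definition stable (V : finType) (e : rel V) (S : {set V}) : bool :=
  [forall x in S, forall y in S, ~~ e x y].

Section Polytopes.
Variables (R : realType) (d : nat).

Definition rho (S : {set 'I_d}) : 'rV[R]_d :=
  \sum_(j in S) delta_mx 0 j.

Definition conv_hull (A : set 'rV[R]_d) : set 'rV[R]_d :=
  [set x | exists (n : nat) (w : 'I_n -> R) (v : 'I_n -> 'rV[R]_d),
     [/\ forall i, 0 <= w i,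
         \sum_i w i = 1,
         forall i, A (v i)
       & x = \sum_i w i *: v i]]%classic.

Definition stable_set_polytope (e : rel 'I_d) : set 'rV[R]_d :=
  conv_hull [set rho S | S in [set S | stable e S]]%classic.

(** [a] lists, without repetition, all the points of [P] with integer
    coordinates; the type of [a] forces them to be nonnegative. *)
Definition enumerates_lattice_points (P : set 'rV[R]_d)
    (N : nat) (a : 'I_N -> 'rV[nat]_d) : Prop :=
  injective a /\
  forall z : 'rV[int]_d,
    P (map_mx intr z) <-> exists i : 'I_N, z = map_mx Posz (a i).

End Polytopes.

Arguments rho R {d} S.
Arguments stable_set_polytope R {d} e.

Section ToricIdeal.
Variables (K : fieldType) (d N : nat).

(** In [{mpoly K[d + 1]}], the variable [t_j] is ['X_(lshift 1 j)] and [s] is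
    the last variable ['X_(rshift d 0)]. *)
Definition toric_monomial (m : 'rV[nat]_d) : {mpoly K[d + 1]} :=
  (\prod_(j < d) 'X_(lshift 1 j) ^+ m 0 j) * 'X_(rshift d 0).

Definition toric_map (a : 'I_N -> 'rV[nat]_d) (p : {mpoly K[N]}) :
    {mpoly K[d + 1]} :=
  p \mPo [tuple toric_monomial (a i) | i < N].

Definition toric_ideal (a : 'I_N -> 'rV[nat]_d) : set {mpoly K[N]} :=
  [set p | toric_map a p = 0]%classic.

End ToricIdeal.

Arguments toric_ideal K {d N} a.

Section Omega.
Variables (K : fieldType) (N : nat).
Implicit Types (I : set {mpoly K[N]}) (S : seq {mpoly K[N]}).

Definition ideal_gen S : set {mpoly K[N]} :=
  [set p | exists c : 'I_(size S) -> {mpoly K[N]},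
     p = \sum_(i < size S) c i * S`_i]%classic.

Definition min_hom_generators I S : Prop :=
  [/\ forall p, p \in S -> exists n : nat, p \is n.-homog,
      ideal_gen S = I
    & forall p, p \in S -> ideal_gen (rem p S) <> I].

(** [(msize p).-1] is the total degree of a nonzero [p]. *)
Definition min_generator_degrees I : set nat :=
  [set n | exists S p,
     [/\ min_hom_generators I S, p \in S & n = (msize p).-1]]%classic.

(** By noetherianity the maximum exists for every nonzero homogeneous ideal;
    the default value [0] of [xget] is only reached on other sets [I]. *)
Definition omega I : nat :=
  if `[< I = [set 0]%classic >] then 2%N
  else xget 0%N [set n | min_generator_degrees I n /\
                         forall m, min_generator_degrees I m -> (m <= n)%N]%classic.

End Omega.

Section Replication.
Variables (d : nat) (e : rel 'I_d) (a : 'I_d -> nat).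

Definition replication_vertex : finType := {i : 'I_d & 'I_(a i)}.

Definition replication_graph : rel replication_vertex :=
  [rel u v | (u != v) && ((tag u == tag v) || e (tag u) (tag v))].

End Replication.

Arguments replication_graph {d} e a.

Section Colorings.
Variables (V : finType) (e : rel V) (k : nat).
Implicit Types f g : {ffun V -> 'I_k}.

Definition vertex_coloring f : bool :=
  [forall u, forall v, e u v ==> (f u != f v)].

Definition color_class f (j : 'I_k) : {set V} := [set v | f v == j].

Definition differ_by_colored_subgraph (m : nat) f g : bool :=
  [exists S : {set 'I_k},
     (#|S| == m) &&
     [forall j, (j \in S) == (color_class f j != color_class g j)]].

Definition recoloring_step (r : nat) : rel {ffun V -> 'I_k} :=
  [rel f g | [exists m : 'I_r.+1, differ_by_colored_subgraph m f g]].

(** The sequence [f = f_0, ..., f_s = g] is [f :: s]. *)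
Definition recoloring_equiv (r : nat) f g : Prop :=
  exists s : seq {ffun V -> 'I_k},
    [/\ all vertex_coloring (f :: s), path (recoloring_step r) f s
      & last f s = g].

End Colorings.

(** The stable set polytope does have an enumeration of its lattice points. *)
Section Existence.
Variables (R : realType) (d : nat) (e : rel 'I_d).

Lemma rhoE (S : {set 'I_d}) j : rho R S 0 j = (j \in S)%:R.
Proof.
rewrite /rho summxE; under eq_bigr do rewrite mxE eqxx /=.
case: (boolP (j \in S)) => jS.
  rewrite (bigD1 j) //= eqxx big1 ?addr0 // => i /andP[_ ij].
  by rewrite eq_sym (negbTE ij).
by rewrite big1 // => i iS; case: eqP => // ji; rewrite ji iS in jS.
Qed.

Lemma rho_nat (S : {set 'I_d}) :
  rho R S = map_mx intr (map_mx Posz (\row_j (j \in S : nat))).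
Proof. by apply/rowP => j; rewrite rhoE !mxE -pmulrn. Qed.

Lemma stable_set_polytope_lattice (z : 'rV[int]_d) : irreflexive e ->
  stable_set_polytope R e (map_mx intr z) <->
  exists2 S, stable e S & z = map_mx Posz (\row_j (j \in S : nat)).
Proof.
move=> eirr; split; last first.
  move=> [S stS ->]; exists 1%N, (fun=> 1), (fun=> rho R S).
  by split; rewrite ?big_ord1 ?scale1r -?rho_nat //= => i; exists S.
case=> n [w [v [w0 w1 vS zE]]].
have zjE j : (z 0 j)%:~R = \sum_i w i * v i 0 j.
  have /rowP /(_ j) := zE; rewrite mxE summxE => ->.
  by under eq_bigr do rewrite mxE.
have z0 j : 0 <= z 0 j.
  rewrite -(ler0z R) zjE sumr_ge0 // => i _.
  by have [S _ <-] := vS i; rewrite rhoE mulr_ge0 ?ler0n.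
have z1 j l : e j l || (j == l) -> z 0 j + (if j == l then 0 else z 0 l) <= 1.
  move=> jl; rewrite -(ler_int R) intrD zjE.
  apply: (@le_trans _ _ (\sum_i w i)); last by rewrite w1.
  case: eqP jl => [_ _|_ jl].
    rewrite addr0 ler_sum // => i _; have [S _ <-] := vS i.
    by rewrite rhoE ler_piMr // lern1 leq_b1.
  rewrite orbF in jl; rewrite zjE -big_split ler_sum //= => i _; rewrite -mulrDr ler_piMr //.
  have [S /= /forall_inP stS <-] := vS i; rewrite !rhoE -natrD lern1 => //.
  case: (boolP (j \in S)) => jS; last by rewrite leq_b1.
  case: (boolP (l \in S)) => // lS.
  by have /forall_inP /(_ l lS) := stS j jS; rewrite jl.
have zb j : z 0 j = 0 \/ z 0 j = 1.
  have := z1 j j; rewrite eqxx orbT addr0 => /(_ isT).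
  by have := z0 j; case: (z 0 j) => [[|[|m]]|m] // _ _; [left|right].
exists [set j | z 0 j == 1].
  apply/forall_inP => j; rewrite inE => /eqP zj.
  apply/forall_inP => l; rewrite inE => /eqP zl; apply/negP => jl.
  have := z1 j l; rewrite jl zj zl; case: eqP => [jl'|_ /(_ isT) //].
  by rewrite jl' eirr in jl.
by apply/rowP => j; rewrite !mxE inE; case: (zb j) => ->.
Qed.

Lemma lattice_enumeration_exists : irreflexive e ->
  exists (N : nat) (pts : 'I_N -> 'rV[nat]_d),
    enumerates_lattice_points (stable_set_polytope R e) pts.
Proof.
move=> eirr; pose A : {set {set 'I_d}} := [set S | stable e S]%SET.
exists #|A|, (fun i : 'I_#|A| => \row_j (j \in (enum_val i : {set 'I_d}) : nat)); split.
  move=> i1 i2 /rowP ri; apply: enum_val_inj; apply/setP => j.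
  by have := ri j; rewrite !mxE; do 2!case: (j \in _).
move=> z; rewrite stable_set_polytope_lattice //; split=> [[S stS ->]|[i ->]].
  have SA : S \in A by rewrite inE.
  by exists (enum_rank_in SA S); rewrite enum_rankK_in.
by exists (enum_val i) => //; have := enum_valP i; rewrite inE.
Qed.

End Existence.

(* Main.v *)
From HB Require Import structures.
Require Import Defs.
From Stdlib Require Import Relation_Operators.
From mathcomp Require Import all_boot all_order all_algebra.
From mathcomp Require Import boolp classical_sets reals perm.
From mathcomp Require Import ssrcomplements mpoly.

(** The toric ideal is spanned by the binomials [x^u - x^v] with [u] and [v] in
    the same fiber of the exponent map, and it is generated in degree at most
    [r] iff every fiber is connected by moves that exchange a divisor of degree
    at most [r] for another one of its fiber. A monomial of degree [k] is a
    [k]-tuple of stable sets up to order, and the [k]-colorings of [G_a] realize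
    the tuples whose monomial lies over [(a, k)], the [j]-th stable set being the
    projection of the [j]-th color class. A move thus changes at most [r] color
    classes. Two colorings with the same monomial are related by permuting colors
    and permuting vertices inside the cliques; a transposition of either kind
    changes at most two color classes, whence the hypothesis [2 <= r]. *)

Set Implicit Arguments.
Unset Strict Implicit.
Unset Printing Implicit Defensive.

Import Order.TTheory GRing.Theory Num.Theory.
Local Open Scope ring_scope.

(** * Degrees of minimal generators *)

(** Unlike [ideal_gen], this allows an infinite generating set, such as all homogeneous elements of
    bounded degree in an ideal, and it supports induction on combinations. *)
Inductive ideal_span (S : comNzRingType) (A : S -> Prop) : S -> Prop :=
| ideal_span0 : ideal_span A 0
| ideal_spanDM c q p : A q -> ideal_span A p -> ideal_span A (c * q + p).

Section IdealSpan.
Variable S : comNzRingType.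
Implicit Types (A B : S -> Prop) (p q c : S).

Lemma ideal_spanD A p q : ideal_span A p -> ideal_span A q -> ideal_span A (p + q).
Proof.
by move=> + Aq; elim=> [|c p' p'' Ap' _ IH]; rewrite ?add0r // -addrA; constructor.
Qed.

Lemma ideal_spanM A c p : ideal_span A p -> ideal_span A (c * p).
Proof.
elim=> [|c' q q' Aq _ IH]; first by rewrite mulr0; constructor.
by rewrite mulrDr mulrA; constructor.
Qed.

Lemma ideal_span_mem A p : A p -> ideal_span A p.
Proof.
by move=> Ap; rewrite -(addr0 p) -(mul1r p); constructor => //; constructor.
Qed.

Lemma ideal_spanS A B p : (forall q, A q -> ideal_span B q) ->
  ideal_span A p -> ideal_span B p.
Proof.
move=> AB; elim=> [|c q p' /AB Bq _ Bp']; first exact: ideal_span0.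
exact/ideal_spanD/Bp'/ideal_spanM.
Qed.

Lemma ideal_span_sum A (I : Type) (s : seq I) (P : pred I) (F : I -> S) :
  (forall i, P i -> ideal_span A (F i)) -> ideal_span A (\sum_(i <- s | P i) F i).
Proof.
move=> AF; apply: big_ind => //; [exact: ideal_span0 | exact: ideal_spanD].
Qed.

End IdealSpan.

Lemma ideal_genP (K : fieldType) (N : nat) (S : seq {mpoly K[N]}) p :
  ideal_gen S p <-> ideal_span (fun q => q \in S) p.
Proof.
split=> [[c ->]|].
  apply: ideal_span_sum => i _; apply: ideal_spanM; apply: ideal_span_mem.
  exact: mem_nth.
elim=> [|c q p' qS _ [c' ->]].
  by exists (fun=> 0); rewrite big1 // => i _; rewrite mul0r.
have iq : (index q S < size S)%N by rewrite index_mem.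
(* The new term is absorbed into the coefficient at the first position of [q]. *)
exists (fun i => c' i + (i == Ordinal iq)%:R * c).
under [RHS]eq_bigr do rewrite mulrDl.
rewrite big_split /= addrC; congr (_ + _).
rewrite (bigD1 (Ordinal iq)) //= eqxx mul1r nth_index // big1 ?addr0 //.
by move=> i /negbTE ->; rewrite mul0r mul0r.
Qed.

Section GeneratorDegrees.
Variables (K : fieldType) (N : nat).
Implicit Types (I : set {mpoly K[N]}) (S : seq {mpoly K[N]}) (p q c : {mpoly K[N]}).

(** By linearity [c] may be a monomial, and then [c * q] is homogeneous. The test [k <= m] guards
    the truncated subtraction, which would otherwise select the constant term of [c]. *)
Lemma pihomogM k m c q : q \is k.-homog ->
  pihomog mdeg m (c * q) = if (k <= m)%N then pihomog mdeg (m - k) c * q else 0.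
Proof.
move=> qk; rewrite [c]mpolyE mulr_suml !linear_sum /=.
transitivity (\sum_(w <- msupp c)
    if (k <= m)%N then pihomog mdeg (m - k) (c@_w *: 'X_[w]) * q else 0).
  apply: eq_bigr => w _; rewrite -scalerAl !linearZ /= pihomogX.
  have wq : 'X_[w] * q \is (mdeg w + k).-homog by rewrite dhomogM ?dhomogX.
  case: leqP => [km|mk].
    case: eqP => [wm|wm]; first by rewrite pihomog_dE ?scalerAl // -(subnK km) -wm.
    rewrite (pihomog_ne0 _ wq) ?scaler0 ?mul0r //.
    by apply/eqP => wkm; apply: wm; rewrite -wkm addnK.
  rewrite (pihomog_ne0 _ wq) ?scaler0 //.
  by rewrite gtn_eqF // (leq_trans mk) ?leq_addl.
by case: ifP => _; [rewrite mulr_suml | rewrite big1].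
Qed.

Definition ideal I : Prop := I 0 /\ forall c p q, I p -> I q -> I (c * p + q).

Definition hom_upto I (D : nat) q : Prop :=
  I q /\ exists2 m, (m <= D)%N & q \is m.-homog.

Lemma ideal_span_sub I (A : {mpoly K[N]} -> Prop) p : ideal I ->
  (forall q, A q -> I q) -> ideal_span A p -> I p.
Proof. by move=> [I0 ID] AI; elim=> // c q p' /AI Iq _ Ip'; apply: ID. Qed.

(* The degree-[m] component of a combination of generators involves only the
   generators of degree at most [m], so one of degree above [D] is redundant. *)
Lemma min_hom_generator_msize I S p D : ideal I ->
  (forall q, I q -> ideal_span (hom_upto I D) q) ->
  min_hom_generators I S -> p \in S -> ((msize p).-1 <= D)%N.
Proof.
move=> Iideal Igen [Shom SI Smin] pS; rewrite leqNgt; apply/negP => Dp.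
apply: (Smin p pS); apply/seteqP; split=> q.
  move=> /ideal_genP; apply: ideal_span_sub => // s /mem_rem sS.
  by rewrite -SI; apply/ideal_genP; apply: ideal_span_mem.
move=> /Igen qD; apply/ideal_genP; apply: ideal_spanS qD => {}q [].
rewrite -SI => /ideal_genP qS [m mD qm]; rewrite -(pihomog_dE qm) => {qm}.
elim: qS => [|c s q' sS _ IH]; first by rewrite linear0; constructor.
rewrite linearD /=; apply: ideal_spanD IH.
have [k sk] := Shom s sS; rewrite (pihomogM _ _ sk).
case: leqP => km; last exact: ideal_span0.
(* The case [s = p] contradicts the degree of [p]; any other [s] survives in [rem p S]. *)
move: sS; rewrite (perm_mem (perm_to_rem pS)) inE => /predU1P[sp|sS].
  have p0 : p != 0 by apply: contraTneq Dp => ->; rewrite msize0.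
  rewrite sp in sk; have pk := dhomog_uniq p0 (dhomog_msize sk) sk.
  by move: (leq_trans km mD); rewrite -pk leqNgt Dp.
by apply: ideal_spanM; apply: ideal_span_mem.
Qed.

(** Redundant generators are removed one at a time, which shortens the list. *)
Lemma min_hom_generators_exists I S : (forall p, p \in S -> exists n, p \is n.-homog) ->
  ideal_gen S = I -> exists S', min_hom_generators I S'.
Proof.
have [k] := ubnP (size S); elim: k S => // k IH S; rewrite ltnS => Sk Shom SI.
have [[p pS pI]|nS] := pselect (exists2 p, p \in S & ideal_gen (rem p S) = I).
  apply: (IH (rem p S)) => // [|q /mem_rem /Shom //].
  rewrite size_rem //; case: (S) pS Sk => //.
by exists S; split=> // p pS pI; apply: nS; exists p.
Qed.

(* Finite generation bounds the generator degrees, which keeps [omega] away from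
   its default value [0]. *)
Lemma omega_leP I S r : ideal I -> (2 <= r)%N ->
  (forall p, p \in S -> exists n, p \is n.-homog) -> ideal_gen S = I ->
  (omega I <= r)%N <-> forall p, I p -> ideal_span (hom_upto I r) p.
Proof.
move=> Iideal r2 Shom SI; rewrite /omega.
case: asboolP => [I0|I0].
  by split=> // _ p; rewrite I0 => ->; constructor.
have [I00 _] := Iideal.
split; last first.
  (* The default value [0] satisfies the bound trivially; otherwise [omega I] is the degree of a
     minimal generator. *)
  move=> Igen; case: xgetP => // n _ [[S' [p [S'min pS' ->]]] _].
  exact: min_hom_generator_msize Igen S'min pS'.
have [S' S'min] := min_hom_generators_exists Shom SI.
have [S'hom S'I _] := S'min.
have deg_bounded : exists D, forall q, I q -> ideal_span (hom_upto I D) q.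
  exists (\max_(s <- S') (msize s).-1)%N => q.
  rewrite -{1}S'I => /ideal_genP; apply: ideal_spanS => s sS'.
  apply: ideal_span_mem; split.
    by rewrite -S'I; apply/ideal_genP; apply: ideal_span_mem.
  have [k sk] := S'hom _ sS'; exists (msize s).-1; last exact: dhomog_msize sk.
  exact: (leq_bigmax_seq (F := fun s : {mpoly K[N]} => (msize s).-1)).
have [D ID] := deg_bounded.
have bnd n : min_generator_degrees I n -> (n <= D)%N.
  by case=> S1 [p [S1min pS1 ->]]; apply: min_hom_generator_msize ID S1min pS1.
have [s0 s0S'] : exists s0, s0 \in S'.
  case: (S') S'I => [S'I|s ? _]; last by exists s; rewrite inE eqxx.
  case: I0; apply/seteqP; split=> p /=; last by move=> ->.
  by rewrite -S'I => -[c ->]; rewrite big_ord0.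
(* The degrees of minimal generators are bounded by [D], and there is one since [S'] is nonempty. So
   a maximum [M] exists and [xget] cannot return its default. *)
pose P n := `[< min_generator_degrees I n >].
have exP : exists n, P n.
  by exists (msize s0).-1; apply/asboolP; exists S', s0.
have PD n : P n -> (n <= D)%N by move=> /asboolP /bnd.
case: (ex_maxnP exP PD) => M /asboolP MI Mmax.
case: xgetP => [n _ [_ nmax] nr q|/(_ M) []]; last first.
  by split=> // m mI; apply: Mmax; apply/asboolP.
rewrite -{1}S'I => /ideal_genP; apply: ideal_spanS => s sS'.
apply: ideal_span_mem; split.
  by rewrite -S'I; apply/ideal_genP; apply: ideal_span_mem.
have [k sk] := S'hom _ sS'; exists (msize s).-1; last exact: dhomog_msize sk.
by apply: leq_trans nr; apply: nmax; exists S', s.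
Qed.

End GeneratorDegrees.

(** * Kernels of monomial maps *)

Section LinearExtension.
Variables (K : fieldType) (n : nat) (V : lmodType K).
Implicit Types (p q : {mpoly K[n]}) (h : 'X_{1..n} -> V).

Definition mlin h p : V := \sum_(m <- msupp p) p@_m *: h m.

(** A sum over an index set independent of [p] allows coefficientwise addition, whence linearity. *)
Lemma mlinwE h w p : (msize p <= w)%N ->
  mlin h p = \sum_(m : 'X_{1..n < w}) p@_m *: h m.
Proof.
move=> pw; rewrite /mlin (big_mksub 'X_{1..n < w}) /=; first last.
- by move=> m /msize_mdeg_lt /leq_trans; apply.
- exact: msupp_uniq.
by rewrite big_rmcond //= => m /memN_msupp_eq0 ->; rewrite scale0r.
Qed.

Lemma mlin_is_linear h : linear (mlin h).
Proof.
move=> c p q; pose w := maxn (msize (c *: p + q)) (maxn (msize p) (msize q)).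
rewrite !(@mlinwE h w); try by rewrite !leq_max leqnn ?orbT.
rewrite scaler_sumr -big_split /=; apply: eq_bigr => m _.
by rewrite mcoeffD mcoeffZ scalerDl scalerA.
Qed.

HB.instance Definition _ h :=
  GRing.isLinear.Build K {mpoly K[n]} V _ (mlin h) (mlin_is_linear h).

Lemma mlinX h m : mlin h 'X_[m] = h m.
Proof. by rewrite /mlin msuppX big_seq1 mcoeffX eqxx scale1r. Qed.

End LinearExtension.

Section Dickson.
Variable E : eqType.
Implicit Types (A : E -> Prop) (cs : seq (E -> nat)).

(** Induction on the list of coordinates. Let [L] work for [cs], and let [M] bound [c] on [L].
    Elements with [c a >= M] are served by [L]; the others lie in the finitely many slices
    [c a = 0, ..., M - 1], each served by the induction hypothesis. *)
Lemma dickson A cs : exists2 L : seq E, (forall l, l \in L -> A l) &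
  forall a, A a -> exists2 l, l \in L & all (fun c => c l <= c a)%N cs.
Proof.
elim: cs A => [|c cs IH] A.
  have [[a Aa]|nA] := pselect (exists a, A a); last first.
    by exists [::] => // a Aa; case: nA; exists a.
  exists [:: a] => [l|b _]; first by rewrite inE => /eqP ->.
  by exists a; rewrite ?inE.
have [L LA LP] := IH A; pose M := \max_(l <- L) c l.
have [L' L'A L'P] : exists2 L' : seq E, (forall l, l \in L' -> A l) &
    forall a, A a -> (c a < M)%N ->
      exists2 l, l \in L' & all (fun c => c l <= c a)%N (c :: cs).
  elim: M => [|M [L1 L1A L1P]]; first by exists [::].
  have [L2 L2A L2P] := IH (fun a => A a /\ c a = M).
  exists (L1 ++ L2) => [l|a Aa].
    by rewrite mem_cat => /orP[/L1A|/L2A[]].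
  rewrite ltnS leq_eqVlt => /orP[/eqP caM|/(L1P _ Aa)[l lL1 la]].
    have [//|l lL2 la] := L2P a; have [_ clM] := L2A l lL2.
    by exists l; rewrite /= ?mem_cat ?lL2 ?orbT // clM caM leqnn.
  by exists l; rewrite ?mem_cat ?lL1.
exists (L ++ L') => [l|a Aa].
  by rewrite mem_cat => /orP[/LA|/L'A].
have [caM|Mca] := ltnP (c a) M.
  by have [l lL' la] := L'P a Aa caM; exists l; rewrite // mem_cat lL' orbT.
have [l lL la] := LP a Aa; exists l; rewrite ?mem_cat ?lL //= la andbT.
by apply: leq_trans Mca; rewrite /M leq_bigmax_seq.
Qed.

End Dickson.

Section MonomialMap.
Variables (K : fieldType) (N n : nat) (A : 'I_N -> 'X_{1..n}).
Implicit Types (u v w m : 'X_{1..N}) (p q : {mpoly K[N]}).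

Definition mexp u : 'X_{1..n} := (\sum_i A i *+ u i)%MM.

Lemma mexpD u v : mexp (u + v)%MM = (mexp u + mexp v)%MM.
Proof.
rewrite /mexp -big_split /=; apply: eq_bigr => i _.
by apply/mnmP => j; rewrite !(mulmnE, mnmDE) mulnDr.
Qed.

Definition monomial_map p : {mpoly K[n]} := p \mPo [tuple 'X_[A i] | i < N].

Lemma monomial_mapX u : monomial_map 'X_[u] = 'X_[mexp u].
Proof.
rewrite /monomial_map comp_mpolyX /mexp.
rewrite (big_morph _ (@mpolyXD n K) (@mpolyX0 n K)); apply: eq_bigr => i _.
by rewrite tnth_mktuple mpolyXn.
Qed.

Lemma monomial_mapE p : monomial_map p = \sum_(m <- msupp p) p@_m *: 'X_[mexp m].
Proof.
rewrite {1}[p]mpolyE /monomial_map raddf_sum /=; apply: eq_bigr => m _.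
by rewrite comp_mpolyZ -/(monomial_map _) monomial_mapX.
Qed.

Lemma mlin_monomial_map (V : lmodType K) (h : 'X_{1..n} -> V) p :
  mlin h (monomial_map p) = \sum_(m <- msupp p) p@_m *: h (mexp m).
Proof.
rewrite monomial_mapE linear_sum; apply: eq_bigr => m _.
by rewrite linearZ /= mlinX.
Qed.

Definition fiber_binomial (D : nat) q := exists u v,
  [/\ mexp u = mexp v, (mdeg u <= D)%N & q = 'X_[u] - 'X_[v]].

(** Replacing each monomial of [p] by a fixed representative of its fiber gives a linear function of
    [monomial_map p], hence [0]. Subtracting it turns [p] into a combination of binomials. *)
Lemma monomial_map_kernel_span p : monomial_map p = 0 ->
  ideal_span (fun q => exists u v, mexp u = mexp v /\ q = 'X_[u] - 'X_[v]) p.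
Proof.
move=> p0.
have /choice[rep repE] t : exists u, (exists u', mexp u' = t) -> mexp u = t.
  have [[u ut]|nt] := pselect (exists u, mexp u = t); first by exists u.
  by exists 0%MM => /nt.
have -> : p = \sum_(m <- msupp p) p@_m *: ('X_[m] - 'X_[rep (mexp m)]).
  under eq_bigr do rewrite scalerBr.
  rewrite big_split /= -mpolyE sumrN.
  by rewrite -(mlin_monomial_map (fun t => 'X_[rep t])) p0 linear0 subr0.
apply: ideal_span_sum => m _; rewrite -mul_mpolyC; apply: ideal_spanM.
apply: ideal_span_mem; exists m, (rep (mexp m)); split=> //.
by rewrite repE //; exists m.
Qed.

Definition fiber_step (r : nat) u v := exists w u' v',
  [/\ u = (w + u')%MM, v = (w + v')%MM, mexp u' = mexp v' & (mdeg u' <= r)%N].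

Lemma fiber_step_span r u v : fiber_step r u v ->
  ideal_span (fiber_binomial r) ('X_[u] - 'X_[v] : {mpoly K[N]}).
Proof.
case=> w [u' [v' [-> -> uv' ur]]].
rewrite !mpolyXD -mulrBr; apply: ideal_spanM; apply: ideal_span_mem.
by exists u', v'.
Qed.

Definition fiber_conn (r : nat) u v : Prop := clos_refl_trans _ (fiber_step r) u v.

(* The pairs [(u, v)] in a common fiber form a submonoid of [N^2N] closed under
   differences, so a pair dominating another nonzero one splits, and Dickson's
   lemma bounds the degree of the pairs that do not. *)
Lemma fiber_binomial_bounded : exists D, forall u v, mexp u = mexp v ->
  ideal_span (fiber_binomial D) ('X_[u] - 'X_[v] : {mpoly K[N]}).
Proof.
pose cs : seq ('X_{1..N} * 'X_{1..N} -> nat) :=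
  [seq (fun p : 'X_{1..N} * 'X_{1..N} => p.1 i) | i <- enum 'I_N] ++
  [seq (fun p : 'X_{1..N} * 'X_{1..N} => p.2 i) | i <- enum 'I_N].
(* [cs] lists the coordinates of both components. Requiring positive degree makes the degree drop
   when a pair of [L] is subtracted. *)
have [L LA LP] := dickson (fun x : 'X_{1..N} * 'X_{1..N} =>
  mexp x.1 = mexp x.2 /\ (0 < mdeg x.1)%N) cs.
pose D := (\max_(l <- L) mdeg l.1)%N; exists D => u v.
have [k] := ubnP (mdeg u); elim: k u v => // k IH u v; rewrite ltnS => uk uv.
have [uD|Du] := leqP (mdeg u) D; first by apply: ideal_span_mem; exists u, v.
have [|[u' v'] lL] := LP (u, v); first by split=> //=; apply: leq_trans Du.
rewrite all_cat !all_map => /andP[/allP /= u'u /allP /= v'v].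
have [/= u'v' u'0] := LA _ lL.
have {u'u}/submK uE : (u' <= u)%MM.
  by apply/mnm_lepP => i; apply: u'u; rewrite -enumT mem_enum.
have {v'v}/submK vE : (v' <= v)%MM.
  by apply/mnm_lepP => i; apply: v'v; rewrite -enumT mem_enum.
have u'D : (mdeg u' <= D)%N.
  exact: (leq_bigmax_seq (F := fun l => mdeg l.1) (u', v')).
have uv'' : mexp (u - u')%MM = mexp (v - v')%MM.
  by apply: (@mpoly.addIm _ (mexp u')); rewrite -mexpD uE u'v' -mexpD vE.
have -> : 'X_[u] - 'X_[v] = 'X_[u - u'] * ('X_[u'] - 'X_[v'])
    + 'X_[v'] * ('X_[u - u'] - 'X_[v - v']) :> {mpoly K[N]}.
  rewrite !mulrBr -!mpolyXD uE !(mpoly.addmC v') vE.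
  by rewrite addrA subrK.
apply: ideal_spanD; apply: ideal_spanM.
  by apply: ideal_span_mem; exists u', v'.
apply: IH uv''; rewrite (leq_trans _ uk) //.
by rewrite -[X in (_ < mdeg X)%N]uE mdegD -addn1 leq_add2l.
Qed.

Definition monomial_kernel : set {mpoly K[N]} := [set p | monomial_map p = 0]%classic.

Lemma monomial_kernel_binomial u v : mexp u = mexp v ->
  monomial_kernel ('X_[u] - 'X_[v]).
Proof.
move=> uv; rewrite /monomial_kernel /= /monomial_map linearB /=.
by rewrite -!/(monomial_map _) !monomial_mapX uv subrr.
Qed.

Hypothesis mdeg_mexp : forall u v, mexp u = mexp v -> mdeg u = mdeg v.

Lemma fiber_binomial_hom D q : fiber_binomial D q -> hom_upto monomial_kernel D q.
Proof.
case=> u [v [uv uD ->]]; split.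
  exact: monomial_kernel_binomial.
exists (mdeg u) => //; rewrite rpredB ?dhomogX //=.
by rewrite (mdeg_mexp uv).
Qed.

(* The sum of the coefficients over the connected component of [u] is a linear
   functional that vanishes on [c * q] for [q] homogeneous of degree at most [r]
   in the kernel: all terms of [q] in a fiber move to the same component. *)
Lemma fiber_conn_of_span r :
  (forall p, monomial_kernel p -> ideal_span (hom_upto monomial_kernel r) p) ->
  forall u v, mexp u = mexp v -> fiber_conn r u v.
Proof.
move=> gen u v uv.
pose chi m : K^o := `[< fiber_conn r u m >]%:R.
have chi0 p : ideal_span (hom_upto monomial_kernel r) p -> mlin chi p = 0.
  elim=> [|c q p' [q0 [k kr qk]] _ IH]; first by rewrite linear0.
  rewrite linearD /= IH addr0 [c]mpolyE mulr_suml linear_sum big1 // => w _.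
  rewrite -scalerAl linearZ /= [X in _ *: X](_ : _ = 0) ?scaler0 //.
  rewrite [q]mpolyE mulr_sumr linear_sum /=.
  (* [h] makes [chi] at [w + m], for [m] a term of [q], a function of [mexp m] alone, so the sum
     factors through [monomial_map q], which is [0]. *)
  pose h t : K^o := `[< exists m,
    [/\ mexp m = t, mdeg m = k & fiber_conn r u (w + m)%MM] >]%:R.
  transitivity (mlin h (monomial_map q)); last by rewrite q0 linear0.
  rewrite mlin_monomial_map.
  apply: eq_big_seq => m mq; rewrite -scalerAr linearZ /= -mpolyXD mlinX.
  congr (_ *: _); rewrite /chi /h; congr (_%:R); congr (nat_of_bool _).
  have mk : mdeg m = k by exact: (dhomogP _ _ _ qk).
  apply: asbool_equiv_eq; split=> [um|[m' [m'm m'k um']]]; first by exists m.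
  by apply: rt_trans um' (rt_step _ _ _ _ _); exists w, m', m; rewrite m'k.
have := chi0 ('X_[u] - 'X_[v]).
rewrite linearB /= !mlinX /chi; case: asboolP => [_|[]]; last exact: rt_refl.
case: asboolP => // _ /(_ _)/eqP; rewrite subr0 oner_eq0 => H.
exfalso; apply/notF/H/gen.
exact: monomial_kernel_binomial.
Qed.

End MonomialMap.

Arguments monomial_kernel K {N n} A.

Section OmegaKernel.
Variables (K : fieldType) (N n : nat) (A : 'I_N -> 'X_{1..n}).
Hypothesis mdeg_mexp : forall u v, mexp A u = mexp A v -> mdeg u = mdeg v.

Lemma monomial_kernel_ideal : ideal (monomial_kernel K A).
Proof.
split; rewrite /monomial_kernel /= /monomial_map ?linear0 // => c p q p0 q0.
by rewrite rmorphD rmorphM /= p0 q0 mulr0 addr0.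
Qed.

(** Binomials of bounded degree generate, and they are finitely many because [v] has the degree of
    [u]. The type of monomials of degree below [D.+1] enumerates them. *)
Lemma monomial_kernel_finitely_generated : exists2 S : seq {mpoly K[N]},
  (forall p, p \in S -> exists n, p \is n.-homog) & ideal_gen S = monomial_kernel K A.
Proof.
have [D binD] := fiber_binomial_bounded K A.
pose T := 'X_{1..N < D.+1}.
pose S := [seq 'X_[x.1] - 'X_[x.2] : {mpoly K[N]} |
             x : T * T <- enum {: T * T} & mexp A x.1 == mexp A x.2].
have SI p : p \in S -> fiber_binomial A D p.
  case/mapP => -[u v]; rewrite mem_filter => /andP[/eqP uv _] ->.
  by exists u, v; rewrite -ltnS bmdeg.
exists S => [p /SI /fiber_binomial_hom [//|_ [m _ ?]]|]; first by exists m.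
apply/seteqP; split=> p.
  move=> /ideal_genP; apply: ideal_span_sub; first exact: monomial_kernel_ideal.
  by move=> q /SI /fiber_binomial_hom [].
move=> /monomial_map_kernel_span pI; apply/ideal_genP.
apply: ideal_spanS pI => _ [u [v [uv ->]]].
apply: ideal_spanS (binD u v uv) => _ [{uv}u [{}v [uv uD ->]]].
have vD : (mdeg v <= D)%N by rewrite -(mdeg_mexp uv).
apply/ideal_span_mem/mapP.
rewrite -ltnS in uD; rewrite -ltnS in vD.
exists (@BMultinom _ _ u uD, @BMultinom _ _ v vD) => //.
by rewrite mem_filter mem_enum /= uv eqxx.
Qed.

(** For the converse direction, the binomial of two connected monomials telescopes along the
    moves. *)
Lemma omega_monomial_kernel_le r : (2 <= r)%N ->
  (omega (monomial_kernel K A) <= r)%N <->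
  forall u v, mexp A u = mexp A v -> fiber_conn A r u v.
Proof.
move=> r2; have [S Shom SI] := monomial_kernel_finitely_generated.
rewrite (omega_leP monomial_kernel_ideal r2 Shom SI).
split=> [gen u v|conn p /monomial_map_kernel_span].
  exact: fiber_conn_of_span gen u v.
apply: ideal_spanS => _ [u [v [/conn uv ->]]].
elim: uv => [x y /(fiber_step_span K)|x|x y z _ xy _ yz].
- by apply: ideal_spanS => q qr; apply/ideal_span_mem/fiber_binomial_hom.
- by rewrite subrr; constructor.
- by rewrite -(subrKA 'X_[y]); apply: ideal_spanD.
Qed.

End OmegaKernel.

(** * Colorings of replication graphs *)

(** If two mismatched places [x] and [y] of one class satisfy [f x = g y], swapping them in [g]
    repairs [x] and spoils nothing, since [y] was already wrong. The number of mismatches drops.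
    This serves both for vertices inside cliques and for the colors themselves. *)
Lemma swap_alignment (X : finType) (Y T : eqType) (c : X -> T)
    (f g : {ffun X -> Y}) (Q : {ffun X -> Y} -> Prop) :
  Q g ->
  (forall h x y, c x = c y -> Q h -> Q [ffun z => h (tperm x y z)]) ->
  exists2 h, Q h & forall x y, c x = c y -> f x != h x -> f y != h y -> f x != h y.
Proof.
move=> Qg Qswap; have [k] := ubnP #|[set x | f x != g x]|.
elim: k g Qg => // k IH g Qg; rewrite ltnS => gk.
have [[[x y] [cxy fx fy fxy]]|aligned] := pselect (exists p : X * X,
    [/\ c p.1 = c p.2, f p.1 != g p.1, f p.2 != g p.2 & f p.1 = g p.2]); last first.
  exists g => // x y cxy fx fy; apply/eqP => fxy.
  by apply: aligned; exists (x, y).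
apply: (IH [ffun z => g (tperm x y z)]); first exact: Qswap.
apply: leq_trans gk; apply/proper_card/properP; split.
  apply/fintype.subsetP => z; rewrite !inE ffunE.
  by case: tpermP => [-> |->|//]; rewrite //= fxy eqxx.
by exists x; rewrite !inE // ffunE tpermL fxy eqxx.
Qed.

Section Recoloring.
Variables (V : finType) (e : rel V) (k r : nat).
Implicit Types f g h : {ffun V -> 'I_k}.

Lemma coloring_neq f u v : vertex_coloring e f -> f u = f v -> ~~ e u v.
Proof.
move=> /forallP /(_ u) /forallP /(_ v) /implyP cf fuv.
by apply/negP => /cf; rewrite fuv eqxx.
Qed.

Lemma recoloring_equiv_refl f : vertex_coloring e f -> recoloring_equiv e r f f.
Proof. by move=> cf; exists [::]; rewrite /= cf. Qed.

Lemma recoloring_equiv_trans f g h :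
  recoloring_equiv e r f g -> recoloring_equiv e r g h -> recoloring_equiv e r f h.
Proof.
case=> s1 [/= /andP[cf c1] p1 l1] [s2 [/= /andP[_ c2] p2 l2]].
by exists (s1 ++ s2); rewrite /= cf all_cat c1 c2 cat_path p1 last_cat l1.
Qed.

(** The set of colors in the definition is forced to be the set of changed colors. *)
Lemma recoloring_stepE f g : recoloring_step r f g =
  (#|[set j | color_class f j != color_class g j]| <= r)%N.
Proof.
apply/existsP/idP => [[m /existsP[S /andP[/eqP Sm /forallP SP]]]|fgr].
  have <- : S = [set j | color_class f j != color_class g j].
    by apply/setP => j; rewrite inE -(eqP (SP j)).
  by rewrite Sm -ltnS.
exists (Ordinal (fgr : (_ < r.+1)%N)); apply/existsP.
exists [set j | color_class f j != color_class g j].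
by rewrite eqxx; apply/forallP => j; rewrite inE.
Qed.

Lemma recoloring_equiv_step f g : vertex_coloring e f -> vertex_coloring e g ->
  (#|[set j | color_class f j != color_class g j]| <= r)%N -> recoloring_equiv e r f g.
Proof.
by move=> cf cg fg; exists [:: g]; rewrite /= cf cg recoloring_stepE fg.
Qed.

End Recoloring.

Section Replication.
Variables (d : nat) (e : rel 'I_d) (a : 'I_d -> nat) (k : nat).
Local Notation V := (replication_vertex a).
Local Notation E := (replication_graph e a).
Implicit Types (f g h : {ffun V -> 'I_k}) (S : 'I_k -> {set 'I_d}) (i : 'I_d) (j : 'I_k).

Definition color_support f j : {set 'I_d} := (@tag _ _) @: color_class f j.

Lemma color_supportP f i j :
  reflect (exists x : 'I_(a i), f (Tagged _ x) = j) (i \in color_support f j).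
Proof.
apply: (iffP imsetP) => [[[i' x]]|[x fx]].
  by rewrite inE => /eqP fx /= ->; exists x.
by exists (Tagged (fun i => 'I_(a i)) x) => //; rewrite inE fx.
Qed.

Lemma coloring_clique_inj f i : vertex_coloring E f ->
  injective (fun x : 'I_(a i) => f (Tagged _ x)).
Proof.
move=> cf x y /= /(coloring_neq cf).
by rewrite /replication_graph /= eqxx andbT negbK eq_Tagged => /eqP.
Qed.

Lemma color_support_stable f j : irreflexive e -> vertex_coloring E f ->
  stable e (color_support f j).
Proof.
move=> e_irr cf; apply/forall_inP => i /color_supportP[x fx].
apply/forall_inP => i' /color_supportP[y fy].
apply/negP => ii'; have := coloring_neq cf (etrans fx (esym fy)).
by rewrite /replication_graph /= ii' orbT andbT negbK => /eqP [ii _]; rewrite ii e_irr in ii'.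
Qed.

Lemma card_color_support f i : vertex_coloring E f ->
  #|[set j | i \in color_support f j]| = a i.
Proof.
move=> cf; rewrite -[RHS]card_ord -(card_imset _ (@coloring_clique_inj f i cf)).
congr #|pred_of_set _|; apply/setP => j; rewrite inE.
apply/color_supportP/imsetP => [[x <-]|[x _ ->]]; by exists x.
Qed.

(** The clique over [i] is colored bijectively with the [a i] colors [j] such that [i \in S j].
    Colors then differ inside a clique, and stability of [S j] separates adjacent cliques. *)
Lemma coloring_with_support S : (forall j, stable e (S j)) ->
  (forall i, #|[set j | i \in S j]| = a i) ->
  exists2 f, vertex_coloring E f & color_support f =1 S.
Proof.
move=> Sst Sa.
pose f : {ffun V -> 'I_k} :=
  [ffun v => enum_val (cast_ord (esym (Sa (tag v))) (tagged v))].
have fS v : tag v \in S (f v).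
  by have := enum_valP (cast_ord (esym (Sa (tag v))) (tagged v)); rewrite inE ffunE.
exists f => [|j].
  apply/forallP => -[i x]; apply/forallP => -[i' y].
  apply/implyP; rewrite /replication_graph /= => /andP[xy ii'].
  apply/eqP => fxy; have := fS (existT _ i x); have := fS (existT _ i' y).
  rewrite -fxy /= => i'S iS.
  case/orP: ii' => [/eqP ii'|]; last first.
    by apply/negP; have /forall_inP /(_ i iS) /forall_inP := Sst (f (existT _ i x)); apply.
  subst i'; move: fxy xy; rewrite !ffunE => /enum_val_inj /cast_ord_inj /= ->.
  by rewrite eqxx.
apply/setP => i; apply/color_supportP/idP => [[x <-]|iS]; first exact: fS.
have jS : j \in [set j | i \in S j] by rewrite inE.
exists (cast_ord (Sa i) (enum_rank_in jS j)).
by rewrite ffunE /= cast_ordK enum_rankK_in.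
Qed.

(** Two vertices of one clique are exchanged by an automorphism of the replication graph, and only
    the classes of [f x] and [f y] can change. *)
Lemma swap_coloring r f (x y : V) : (2 <= r)%N -> tag x = tag y ->
  vertex_coloring E f -> let g := [ffun z => f (tperm x y z)] in
  [/\ vertex_coloring E g, recoloring_equiv E r g f & color_support g =1 color_support f].
Proof.
move=> r2 xy cf g.
have tag_tperm z : tag (tperm x y z) = tag z by case: tpermP => // ->.
have cg : vertex_coloring E g.
  apply/forallP => u; apply/forallP => v; apply/implyP; rewrite /replication_graph /= => uv.
  have /forallP /(_ (tperm x y u)) /forallP /(_ (tperm x y v)) := cf.
  by rewrite !ffunE /replication_graph /= (inj_eq perm_inj) !tag_tperm uv.
split=> // [|j].
  apply: recoloring_equiv_step => //; apply: leq_trans r2.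
  apply: (@leq_trans #|[set f x; f y]|); last by rewrite cards2; case: eqP.
  apply/subset_leq_card/fintype.subsetP => j; rewrite !inE; apply: contraR.
  rewrite negb_or => /andP[jx jy]; apply/eqP/setP => z; rewrite !inE ffunE.
  by case: tpermP => // ->; rewrite !(eq_sym _ j) (negbTE jx) (negbTE jy).
(* One inclusion for every [h] suffices: the swap is an involution, so applying it to [f] and to [g]
   gives equality. *)
have sub (h : {ffun V -> 'I_k}) :
    color_support [ffun z => h (tperm x y z)] j \subset color_support h j.
  apply/fintype.subsetP => i /imsetP[z]; rewrite inE ffunE => hz ->; rewrite -tag_tperm.
  by apply: imset_f; rewrite inE.
apply/eqP; rewrite finset.eqEsubset sub (fintype.subset_trans _ (sub g)) //.
rewrite (_ : [ffun z => _] = f) //; apply/ffunP => z.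
by rewrite !ffunE tpermK.
Qed.

(* Swapping colors inside the cliques, [g] is made to agree with [f] on every
   color class meeting the same cliques in both colorings. *)
Lemma coloring_alignment r f g : (2 <= r)%N ->
  vertex_coloring E f -> vertex_coloring E g ->
  (#|[set j | color_support f j != color_support g j]| <= r)%N ->
  recoloring_equiv E r f g.
Proof.
move=> r2 cf cg fg.
have [||h [ch hg sh] hP] := @swap_alignment V 'I_k 'I_d (@tag _ _) f g
    (fun h => [/\ vertex_coloring E h, recoloring_equiv E r h g
                & color_support h =1 color_support g]).
- by split=> //; exact: recoloring_equiv_refl.
- move=> h x y xy [ch hg sh].
  have [cs sE ss] := swap_coloring r2 xy ch.
  by split=> // [|j]; [exact: recoloring_equiv_trans hg | rewrite ss sh].
apply: recoloring_equiv_trans hg; apply: recoloring_equiv_step => //.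
apply: leq_trans fg; apply/subset_leq_card/fintype.subsetP => j; rewrite !inE.
apply: contraNneq; rewrite -sh => fhj.
(* If only one of the colorings gives [x] the color [j], the other uses [j] at some [y] of the same
   clique. Both places are mismatched, contradicting [hP]. *)
apply/eqP/setP => -[i x]; rewrite !inE; apply/eqP/eqP => [fj|hj]; apply/eqP; apply: contraT.
  move=> hj; have /color_supportP[y hy] : i \in color_support h j.
    by rewrite -fhj; apply/color_supportP; exists x.
  have fy : f (existT _ i y) != h (existT _ i y).
    rewrite hy; apply: contraNneq hj => fy.
    by rewrite (coloring_clique_inj cf (etrans fj (esym fy))) hy.
  have := hP (existT _ i x) (existT _ i y) erefl _ fy.
  by rewrite fj hy eq_sym hj eqxx => /(_ isT).
move=> fj; have /color_supportP[y fy] : i \in color_support f j.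
  by rewrite fhj; apply/color_supportP; exists x.
have hy : f (existT _ i y) != h (existT _ i y).
  rewrite fy eq_sym; apply: contraNneq fj => hy.
  by rewrite (coloring_clique_inj ch (etrans hj (esym hy))) fy.
have := hP (existT _ i y) (existT _ i x) erefl hy.
by rewrite fy hj eqxx fj => /(_ isT).
Qed.

End Replication.

(** * Monomials in stable sets as colorings *)

Section IndexedMonomials.
Variables (N n : nat) (A : 'I_N -> 'X_{1..n}).

Definition mnm_of k (P : {ffun 'I_k -> 'I_N}) : 'X_{1..N} := (\sum_j U_(P j))%MM.

Lemma mdeg_mnm_of k (P : {ffun 'I_k -> 'I_N}) : mdeg (mnm_of P) = k.
Proof.
by rewrite mdeg_sum (eq_bigr (fun=> 1%N)) => [|j _]; rewrite ?mdeg1 // sum1_card card_ord.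
Qed.

Lemma mnm_ofE k (P : {ffun 'I_k -> 'I_N}) i : mnm_of P i = #|[set j | P j == i]|.
Proof.
rewrite mnm_sumE -sum1dep_card [RHS]big_mkcond; apply: eq_bigr => j _.
by rewrite mnm1E; case: eqP.
Qed.

Lemma mnm_of_surj u : exists P : {ffun 'I_(mdeg u) -> 'I_N}, mnm_of P = u.
Proof.
(* With the degree as a variable, the index type no longer depends on [u] and the induction can peel
   off one variable. *)
have [k uk] : exists k, mdeg u = k by exists (mdeg u).
rewrite uk; elim: k u uk => [|k IH] u uk.
  exists [ffun j : 'I_0 => False_rect _ (notF (ltn_ord j))].
  by rewrite /mnm_of big_ord0; apply/esym/eqP; rewrite -mdeg_eq0 uk.
have [i iu] : exists i, (U_(i) <= u)%MM.
  apply/existsP; apply: contraT => /existsPn u0.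
  move: uk; rewrite mdegE big1 // => i _; apply/eqP.
  by have := u0 i; rewrite lep1mP negbK.
have [P PE] : exists P : {ffun 'I_k -> 'I_N}, mnm_of P = (u - U_(i))%MM.
  apply: IH; apply/eqP.
  by rewrite -(eqn_add2r (mdeg U_(i))) -mdegD submK // uk mdeg1 addn1.
exists [ffun j => if unlift ord0 j is Some j' then P j' else i].
rewrite /mnm_of big_ord_recl ffunE unlift_none -[RHS](submK iu) -PE mpoly.addmC.
by congr (_ + _)%MM; apply: eq_bigr => j _; rewrite ffunE liftK.
Qed.

Lemma mexp1 i : mexp A U_(i) = A i.
Proof.
rewrite /mexp (bigD1 i) //= mnm1E eqxx mulm1n big1 ?mpoly.addm0 // => j ji.
by rewrite mnm1E eq_sym (negbTE ji) mulm0n.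
Qed.

Lemma mexp0 : mexp A 0%MM = 0%MM.
Proof. by rewrite /mexp big1 // => i _; rewrite mnm0E mulm0n. Qed.

Lemma mexp_mnm_of k (P : {ffun 'I_k -> 'I_N}) : mexp A (mnm_of P) = (\sum_j A (P j))%MM.
Proof.
rewrite /mnm_of (big_morph _ (mexpD A) mexp0).
by apply: eq_bigr => j _; rewrite mexp1.
Qed.

(** The positions where [P] and [Q] agree form the common factor [w], whose exponent cancels. *)
Lemma mnm_of_fiber_step r k (P Q : {ffun 'I_k -> 'I_N}) :
  mexp A (mnm_of P) = mexp A (mnm_of Q) -> (#|[set j | P j != Q j]| <= r)%N ->
  fiber_step A r (mnm_of P) (mnm_of Q).
Proof.
move=> PQ PQr; pose w := (\sum_(j | P j == Q j) U_(P j))%MM.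
have PE : mnm_of P = (w + \sum_(j | P j != Q j) U_(P j))%MM.
  by rewrite /mnm_of (bigID (fun j => P j == Q j)).
have QE : mnm_of Q = (w + \sum_(j | P j != Q j) U_(Q j))%MM.
  rewrite /mnm_of (bigID (fun j => P j == Q j)) /=; congr (_ + _)%MM.
  by apply: eq_bigr => j /eqP ->.
do 3!eexists; split; [exact: PE|exact: QE| |].
  by apply: (@mpoly.addmI _ (mexp A w)); rewrite -!mexpD -PE -QE.
rewrite mdeg_sum (eq_bigr (fun=> 1%N)) => [|j _]; rewrite ?mdeg1 //.
by rewrite sum1dep_card.
Qed.

End IndexedMonomials.

Section StableMonomials.
Variables (d : nat) (e : rel 'I_d) (N : nat) (st : 'I_N -> {set 'I_d}).
Variable A : 'I_N -> 'X_{1..d + 1}.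
Hypotheses (e_irr : irreflexive e) (st_inj : injective st)
  (st_stable : forall i, stable e (st i))
  (st_surj : forall S, stable e S -> exists i, st i = S)
  (A_vertex : forall i x, A i (lshift 1 x) = (x \in st i))
  (A_degree : forall i y, A i (rshift d y) = 1%N).

Lemma stable_mexpE k (P : {ffun 'I_k -> 'I_N}) x :
  mexp A (mnm_of P) (lshift 1 x) = #|[set j | x \in st (P j)]|.
Proof.
rewrite mexp_mnm_of mnm_sumE -sum1dep_card [RHS]big_mkcond; apply: eq_bigr => j _.
by rewrite A_vertex; case: (x \in _).
Qed.

(** The exponent of the last variable [s] counts the factors. *)
Lemma stable_mdeg_mexp u v : mexp A u = mexp A v -> mdeg u = mdeg v.
Proof.
have mdE w : mexp A w (rshift d ord0) = mdeg w.
  have [P <-] := mnm_of_surj w; rewrite mexp_mnm_of mnm_sumE mdeg_mnm_of.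
  by rewrite (eq_bigr (fun=> 1%N)) ?sum1_card ?card_ord.
by move=> uv; rewrite -!mdE uv.
Qed.

Lemma stable_mexp_eqP k (P Q : {ffun 'I_k -> 'I_N}) :
  (forall x, #|[set j | x \in st (P j)]| = #|[set j | x \in st (Q j)]|) ->
  mexp A (mnm_of P) = mexp A (mnm_of Q).
Proof.
move=> PQ; apply/mnmP => y; rewrite -(splitK y); case: split => {}y /=.
  by rewrite !stable_mexpE PQ.
rewrite !mexp_mnm_of !mnm_sumE; apply: eq_bigr => j _.
by rewrite !A_degree.
Qed.

Section FixedReplication.
Variables (a : 'I_d -> nat) (r : nat).
Hypothesis r_ge2 : (2 <= r)%N.
Local Notation V := (replication_vertex a).
Local Notation E := (replication_graph e a).

Definition profile k (f : {ffun V -> 'I_k}) (P : {ffun 'I_k -> 'I_N}) : Prop :=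
  vertex_coloring E f /\ forall j, color_support f j = st (P j).

Lemma profile_exists k (f : {ffun V -> 'I_k}) :
  vertex_coloring E f -> exists P, profile f P.
Proof.
move=> cf; have /choice[P PE] j : exists i, st i = color_support f j.
  exact/st_surj/color_support_stable.
by exists [ffun j => P j]; split=> // j; rewrite ffunE PE.
Qed.

Lemma profile_card k (f : {ffun V -> 'I_k}) P x :
  profile f P -> #|[set j | x \in st (P j)]| = a x.
Proof.
case=> cf fP; rewrite -(card_color_support x cf).
by apply: eq_card => j; rewrite !inE fP.
Qed.

Lemma profile_realize k (P : {ffun 'I_k -> 'I_N}) :
  (forall x, #|[set j | x \in st (P j)]| = a x) -> exists f, profile f P.
Proof.
move=> Pa; have [//|f cf fP] := @coloring_with_support d e a k (fun j => st (P j)) _ Pa.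
by exists f.
Qed.

(** A tuple comes from a coloring as soon as it covers each [x] exactly [a x] times, a condition on
    its exponent alone. *)
Lemma profile_move k (f : {ffun V -> 'I_k}) P (Q : {ffun 'I_k -> 'I_N}) :
  profile f P -> mexp A (mnm_of P) = mexp A (mnm_of Q) -> exists g, profile g Q.
Proof.
move=> fP PQ; apply: profile_realize => x.
by rewrite -stable_mexpE -PQ stable_mexpE (profile_card _ fP).
Qed.

Lemma profile_equiv k (f g : {ffun V -> 'I_k}) P Q : profile f P -> profile g Q ->
  (#|[set j | P j != Q j]| <= r)%N -> recoloring_equiv E r f g.
Proof.
move=> [cf fP] [cg gQ] PQ; apply: coloring_alignment => //.
apply: leq_trans PQ; apply/subset_leq_card/fintype.subsetP => j.
by rewrite !inE fP gQ (inj_eq st_inj).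
Qed.

(* Swapping colors, the profile of [f] is made equal to that of [g]. *)
Lemma profile_perm_equiv k (f g : {ffun V -> 'I_k}) P Q : profile f P -> profile g Q ->
  mnm_of P = mnm_of Q -> recoloring_equiv E r f g.
Proof.
move=> fP gQ PQ.
(* The constant labeling lets any two colors be swapped. *)
have [||Q' [mQ' [g' g'Q' g'g]] Q'P] := @swap_alignment 'I_k 'I_N unit (fun=> tt) P Q
    (fun Q' => mnm_of Q' = mnm_of Q /\ exists2 g', profile g' Q' & recoloring_equiv E r g' g).
- by split=> //; exists g => //; apply: recoloring_equiv_refl; case: gQ.
- move=> Q1 x y _ [mQ1 [g1 g1Q1 g1g]].
  have mQ2 : mnm_of [ffun z => Q1 (tperm x y z)] = mnm_of Q.
    rewrite -mQ1 /mnm_of [RHS](reindex_inj (@perm_inj _ (tperm x y))) /=.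
    by apply: eq_bigr => z _; rewrite ffunE.
  split=> //; have [g2 g2Q2] := profile_move gQ (esym (congr1 (mexp A) mQ2)).
  exists g2 => //; apply: recoloring_equiv_trans g1g.
  apply: profile_equiv g2Q2 g1Q1 _; apply: leq_trans r_ge2.
  apply: (@leq_trans #|[set x; y]|); last by rewrite cards2; case: eqP.
  apply/subset_leq_card/fintype.subsetP => z; rewrite !inE ffunE.
  by case: tpermP => [->|->|]; rewrite ?eqxx ?orbT.
(* At a mismatch [j], every position where [Q'] takes the value [P j] also has that value in [P],
   but [j] itself has it only in [P]. The multiplicities of [P j] would differ. *)
have PQ' : P = Q'.
  apply/ffunP => j; apply/eqP; apply: contraT => PQj.
  have : (mnm_of Q' (P j) < mnm_of P (P j))%N.
    rewrite !mnm_ofE; apply/proper_card/properP; split; last first.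
      by exists j; rewrite !inE ?eqxx // eq_sym.
    apply/fintype.subsetP => l; rewrite !inE => Ql; apply: contraT => Pl.
    by have := Q'P j l erefl PQj; rewrite (eqP Ql) eqxx => /(_ Pl).
  by rewrite mQ' PQ ltnn.
apply: recoloring_equiv_trans g'g; apply: profile_equiv fP g'Q' _.
by rewrite PQ' eq_card0 // => j; rewrite !inE eqxx.
Qed.

(** The tuple is first reordered so that the factors of [w] precede those of [u'], without changing
    the monomial. The move then alters only the last [mdeg u'] positions. *)
Lemma fiber_step_equiv k (f : {ffun V -> 'I_k}) P v : profile f P ->
  fiber_step A r (mnm_of P) v ->
  exists g Q, [/\ profile g Q, mnm_of Q = v & recoloring_equiv E r f g].
Proof.
move=> + [w [u' [v' [PE vE uv' ur]]]].
have : mdeg (mnm_of P) = (mdeg w + mdeg u')%N by rewrite PE mdegD.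
rewrite mdeg_mnm_of => kE; subst k => fP.
have [Pw PwE] := mnm_of_surj w; have [Pu PuE] := mnm_of_surj u'.
have := mnm_of_surj v'; rewrite -(stable_mdeg_mexp uv') => -[Pv PvE].
pose glue (S : {ffun 'I_(mdeg u') -> 'I_N}) : {ffun 'I_(mdeg w + mdeg u') -> 'I_N} :=
  [ffun j => match split j with inl j => Pw j | inr j => S j end].
have glueE S : mnm_of (glue S) = (w + mnm_of S)%MM.
  rewrite -{2}PwE /mnm_of big_split_ord; congr (_ + _)%MM; apply: eq_bigr => j _.
    by rewrite ffunE (unsplitK (inl j)).
  by rewrite ffunE (unsplitK (inr j)).
have PP : mnm_of P = mnm_of (glue Pu) by rewrite glueE PuE.
have PQ : mexp A (mnm_of P) = mexp A (mnm_of (glue Pv)).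
  by rewrite glueE PvE PE !mexpD uv'.
have [f' f'P] := profile_move fP (congr1 (mexp A) PP).
have [g gQ] := profile_move fP PQ.
exists g, (glue Pv); split=> //; first by rewrite glueE PvE.
apply: recoloring_equiv_trans (profile_perm_equiv fP f'P PP) _.
apply: profile_equiv f'P gQ _; apply: leq_trans ur.
rewrite -[X in (_ <= X)%N]card_ord -[X in (_ <= X)%N](card_imset _ (@rshift_inj (mdeg w) _)).
apply/subset_leq_card/fintype.subsetP => j; rewrite inE !ffunE.
rewrite -{3}(splitK j); case: split => [j'|j'] /=; first by rewrite eqxx.
by move=> _; apply: imset_f.
Qed.

(** The moves lift one by one to colorings. The last one need only share the monomial of [g], so a
    permutation of colors finishes. *)
Lemma fiber_conn_equiv k (f g : {ffun V -> 'I_k}) P Q : profile f P -> profile g Q ->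
  fiber_conn A r (mnm_of P) (mnm_of Q) -> recoloring_equiv E r f g.
Proof.
move=> fP gQ.
suff walk u v : fiber_conn A r u v -> forall (f : {ffun V -> 'I_k}) P,
    profile f P -> mnm_of P = u ->
    exists g Q, [/\ profile g Q, mnm_of Q = v & recoloring_equiv E r f g].
  move=> /walk /(_ f P fP erefl) [g' [Q' [g'Q' Q'Q fg']]].
  exact: recoloring_equiv_trans fg' (profile_perm_equiv g'Q' gQ Q'Q).
elim=> {f g P Q fP gQ u v} [u v uv|u|u w v _ IHu _ IHw] f P fP uE.
- by apply: fiber_step_equiv fP _; rewrite uE.
- by exists f, P; split=> //; apply: recoloring_equiv_refl; case: fP.
have [f1 [P1 [f1P1 P1w ff1]]] := IHu f P fP uE.
have [f2 [P2 [f2P2 P2v f1f2]]] := IHw f1 P1 f1P1 P1w.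
by exists f2, P2; split=> //; apply: recoloring_equiv_trans f1f2.
Qed.

(** A color class that a recoloring step keeps has the same support, so the profile changes in at
    most [r] positions. *)
Lemma equiv_fiber_conn k (f g : {ffun V -> 'I_k}) P Q : profile f P -> profile g Q ->
  recoloring_equiv E r f g -> fiber_conn A r (mnm_of P) (mnm_of Q).
Proof.
move=> + gQ [s [+ + fg]].
elim: s f P fg => [|f1 s IH] f P /= fg fP.
  move=> _ _; rewrite fg in fP; have -> : P = Q.
    by apply/ffunP => j; apply: st_inj; case: fP gQ => _ <- [_ <-].
  exact: rt_refl.
move=> /andP[cf cs] /andP[ff1 ps].
have [P1 f1P1] : exists P1, profile f1 P1 by apply: profile_exists; case/andP: cs.
apply: rt_trans (IH f1 P1 fg f1P1 cs ps); apply: rt_step.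
apply: mnm_of_fiber_step.
  by apply: stable_mexp_eqP => x; rewrite (profile_card x fP) (profile_card x f1P1).
move: ff1; rewrite recoloring_stepE => /(leq_trans _); apply.
apply/subset_leq_card/fintype.subsetP => j; rewrite !inE.
apply: contraNneq => ff1; apply/eqP/st_inj.
by case: fP f1P1 => _ <- [_ <-]; rewrite /color_support ff1.
Qed.

End FixedReplication.

Lemma fiber_conn_recoloring r : (2 <= r)%N ->
  (forall u v, mexp A u = mexp A v -> fiber_conn A r u v) <->
  (forall (a : 'I_d -> nat) (k : nat) (f g : {ffun replication_vertex a -> 'I_k}),
    vertex_coloring (replication_graph e a) f ->
    vertex_coloring (replication_graph e a) g ->
    recoloring_equiv (replication_graph e a) r f g).
Proof.
move=> r2; split=> [conn a k f g cf cg|recol u v uv].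
  have [P fP] := profile_exists cf; have [Q gQ] := profile_exists cg.
  apply: (fiber_conn_equiv r2 fP gQ); apply/conn/stable_mexp_eqP => x.
  by rewrite (profile_card x fP) (profile_card x gQ).
have [P PE] := mnm_of_surj u; have := mnm_of_surj v.
rewrite -(stable_mdeg_mexp uv) => -[Q QE].
(* The replication vector is the vertex part of the common exponent of [u] and [v]. *)
pose a x := #|[set j | x \in st (P j)]|.
have [f fP] : exists f, @profile a _ f P by apply: profile_realize.
have [g gQ] : exists g, @profile a _ g Q by apply: profile_move fP _; rewrite PE QE.
rewrite -PE -QE; apply: (equiv_fiber_conn fP gQ).
by apply: recol; [case: fP | case: gQ].
Qed.

End StableMonomials.

(** * The toric ideal as the kernel of a monomial map *)

Section ToricMonomials.
Variables (K : fieldType) (d : nat).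

Definition toric_exponent (m : 'rV[nat]_d) : 'X_{1..d + 1} :=
  ((\sum_(j < d) U_(lshift 1 j) *+ m ord0 j) + U_(rshift d ord0))%MM.

Lemma toric_exponent_lshift m j : toric_exponent m (lshift 1 j) = m 0 j.
Proof.
rewrite mnmDE mnm_sumE mnm1E eq_rlshift addn0 (bigD1 j) //= big1 => [|i ij].
  by rewrite mulmnE mnm1E eqxx mul1n addn0.
by rewrite mulmnE mnm1E eq_lshift (negbTE ij) mul0n.
Qed.

Lemma toric_exponent_rshift m y : toric_exponent m (rshift d y) = 1%N.
Proof.
rewrite mnmDE mnm_sumE mnm1E (ord1 y) eqxx big1 // => i _.
by rewrite mulmnE mnm1E eq_lrshift mul0n.
Qed.

Lemma toric_monomialE m : toric_monomial K m = 'X_[toric_exponent m].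
Proof.
rewrite mpolyXD (big_morph _ (@mpolyXD _ K) (@mpolyX0 _ K)).
by congr (_ * _); apply: eq_bigr => j _; rewrite mpolyXn.
Qed.

Lemma toric_idealE N (pts : 'I_N -> 'rV[nat]_d) :
  toric_ideal K pts = monomial_kernel K (fun i => toric_exponent (pts i)).
Proof.
rewrite /toric_ideal /monomial_kernel; congr [set p | _]%classic.
apply/funext => p; rewrite /toric_map /monomial_map; congr (_ \mPo _ = 0).
by apply: eq_from_tnth => i; rewrite !tnth_mktuple toric_monomialE.
Qed.

End ToricMonomials.

Theorem theorem3p1 (R : realType) (K : fieldType) (d : nat) (e : rel 'I_d)
    (e_sym : ssrbool.symmetric e) (e_irr : irreflexive e)
    (r : nat) (r_ge2 : (2 <= r)%N)
    (N : nat) (pts : 'I_N -> 'rV[nat]_d)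
    (pts_enum : enumerates_lattice_points (stable_set_polytope R e) pts) :
  (omega (toric_ideal K pts) <= r)%N <->
  forall (a : 'I_d -> nat) (k : nat)
         (f g : {ffun replication_vertex a -> 'I_k}),
    vertex_coloring (replication_graph e a) f ->
    vertex_coloring (replication_graph e a) g ->
    recoloring_equiv (replication_graph e a) r f g.
Proof.
have [pts_inj ptsP] := pts_enum.
(* Lattice points of the polytope are 0/1 vectors, so each is recovered from its support, a stable
   set. *)
pose st i : {set 'I_d} := [set j | pts i 0 j != 0%N].
have ptsE i : stable e (st i) /\ pts i = \row_j (j \in st i : nat).
  have /(stable_set_polytope_lattice R _ e_irr) [S eS ptsS] :
      stable_set_polytope R e (map_mx intr (map_mx Posz (pts i))).
    by apply/ptsP; exists i.
  have {}ptsS j : pts i 0 j = (j \in S).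
    by have /rowP /(_ j) := ptsS; rewrite !mxE => -[].
  have -> : st i = S by apply/setP => j; rewrite inE ptsS eqb0 negbK.
  by split=> //; apply/rowP => j; rewrite mxE ptsS.
rewrite toric_idealE omega_monomial_kernel_le //; last first.
  by apply: stable_mdeg_mexp => i y; rewrite toric_exponent_rshift.
apply: (@fiber_conn_recoloring d e N st) => //.
- by move=> i i' ii'; apply: pts_inj; rewrite (ptsE i).2 (ptsE i').2 ii'.
- by move=> i; case: (ptsE i).
- move=> S eS; have /ptsP [i /rowP zi] :
      stable_set_polytope R e (map_mx intr (map_mx Posz (\row_j (j \in S : nat)))).
    by apply/stable_set_polytope_lattice => //; exists S.
  exists i; apply/setP => j; have := zi j; rewrite inE !mxE => -[<-].
  by rewrite eqb0 negbK.
- by move=> i x; rewrite toric_exponent_lshift {1}(ptsE i).2 mxE.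
- by move=> i y; rewrite toric_exponent_rshift.
Qed.
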